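(* Let $\mathfrak g$ be a graded vector space and let $\mathfrak M_{p,q}:\mathsf S^p(\mathfrak g)\otimes \mathsf S^q(\mathfrak g)\to\mathfrak g$, $p\ge 0,q\ge1$, be a family of graded linear maps of degree $1$. Then $(\mathfrak g,\{\mathfrak M_{p,q}\}_{p\ge0,q\ge1})$ is a post-Lie$_\infty$ algebra if and only if $(\mathfrak g,\mathfrak g,\{l^C_k\}_{k=1}^{+\infty},\{\mathfrak M_{p,q}\}_{p+q\ge1})$ is an open-closed homotopy Lie algebra, where $$l^C_k(x_1,\ldots,x_k)=\sum_{j=0}^{k-1}\sum_{\sigma\in\mathbb S_{(j,k-j)}}\varepsilon(\sigma)\,\mathfrak M_{j,k-j}(x_{\sigma(1)} \cdots x_{\sigma(j)}\otimes x_{\sigma(j+1)} \cdots x_{\sigma(k)}),\quad k\ge1,\qquad\text{and}\qquad \mathfrak M_{p,0}=0\ \text{ for all } p\ge 1.$$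
   Context: The ground field has characteristic zero; graded means $\mathbb Z$-graded; in exponents of $-1$ a homogeneous element stands for its degree. $\mathsf S(V)$ is the graded symmetric algebra, products in it are written by juxtaposition; $\mathbb S_{(i_1,\dots,i_k)}$ is the set of $(i_1,\dots,i_k)$-shuffles; $\varepsilon(\sigma)$ is the Koszul sign: $v_1\cdots v_n=\varepsilon(\sigma)v_{\sigma(1)}\cdots v_{\sigma(n)}$ in $\mathsf S(V)$. An $L_\infty$-algebra $(\mathfrak g,\{l_k\}_{k\ge1})$ is a graded vector space with graded symmetric maps $l_k:\mathsf S^k(\mathfrak g)\to\mathfrak g$ of degree $1$ such that for all $n\ge1$: $\sum_{i=1}^{n}\sum_{\sigma\in \mathbb S_{(i,n-i)}}\varepsilon(\sigma)l_{n-i+1}(l_i(x_{\sigma(1)},\ldots,x_{\sigma(i)}),x_{\sigma(i+1)},\ldots,x_{\sigma(n)})=0$. A post-Lie$_\infty$ algebra is a graded vector space $\mathfrak g$ with linear maps $\mathfrak M_{p,q}:\mathsf S^p(\mathfrak g)\otimes \mathsf S^q(\mathfrak g)\to\mathfrak g$ of degree $1$, $p\ge0,q\ge1$, such that for all $n\ge 0,m\ge1$ and homogeneous $x_1,\dots,x_{n+m}$ $$\begin{aligned}&\sum_{\substack{0\le j\le n-1,\,1\le i\le n\\ i+j\le n}}\ \sum_{\sigma\in \mathbb S_{(j,i,n-j-i)}}\varepsilon(\sigma)\mathfrak M_{n-j-i+1,m}\Big(\mathfrak M_{j,i}(x_{\sigma(1)}\cdots x_{\sigma(j)}\otimes x_{\sigma(j+1)}\cdots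 x_{\sigma(j+i)})x_{\sigma(j+i+1)}\cdots x_{\sigma(n)}\otimes x_{n+1}\cdots x_{n+m}\Big)\\ &+\sum_{0\le j\le n}\sum_{\sigma\in\mathbb S_{(n-j,j)}}\sum_{1\le i\le m}\sum_{\tau\in\mathbb S_{(i,m-i)}}\varepsilon(\sigma)\varepsilon(\tau)(-1)^{x_{\sigma(1)}+\cdots+x_{\sigma(n-j)}}\\ &\mathfrak M_{n-j,m-i+1}\Big(x_{\sigma(1)} \cdots x_{\sigma(n-j)}\otimes \mathfrak M_{j,i}\big(x_{\sigma(n-j+1)} \cdots x_{\sigma(n)}\otimes x_{n+\tau(1)} \cdots x_{n+\tau(i)}\big) x_{n+\tau(i+1)} \cdots x_{n+\tau(m)}\Big)=0.\end{aligned}$$ An open-closed homotopy Lie algebra $(\mathfrak g,\mathfrak h,\{l_k\}_{k\ge1},\{\mathfrak R_{p,q}\}_{p+q\ge1})$ is an $L_\infty$-algebra $(\mathfrak g,\{l_k\})$, a graded vector space $\mathfrak h$ and degree $1$ linear maps $\mathfrak R_{p,q}:\mathsf S^p(\mathfrak g)\otimes \mathsf S^q(\mathfrak h)\to\mathfrak h$ ($p,q\ge0$, $p+q\ge1$; put $\mathfrak R_{0,0}=0$) such that for all $n+m\ge1$, $x_i\in\mathfrak g$, $u_j\in\mathfrak h$ $$\begin{aligned}&\sum_{i=1}^{n}\sum_{\sigma\in \mathbb S_{(i,n-i)}}\varepsilon(\sigma)\mathfrak R_{n-i+1,m}\Big(l_i(x_{\sigma(1)},\ldots,x_{\sigma(i)})x_{\sigma(i+1)}\cdots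 x_{\sigma(n)}\otimes u_1 \cdots u_m\Big)\\ &+\sum_{i=0}^{n}\sum_{k=0}^{m}\sum_{\sigma\in\mathbb S_{(i,n-i)}}\sum_{\tau\in\mathbb S_{(k,m-k)}}\varepsilon(\sigma)\varepsilon(\tau)(-1)^{x_{\sigma(1)}+\cdots+x_{\sigma(i)}}\\ &\mathfrak R_{i,m-k+1}\Big(x_{\sigma(1)} \cdots x_{\sigma(i)}\otimes \mathfrak R_{n-i,k}\big(x_{\sigma(i+1)} \cdots x_{\sigma(n)}\otimes u_{\tau(1)} \cdots u_{\tau(k)}\big) u_{\tau(k+1)} \cdots u_{\tau(m)}\Big)=0.\end{aligned}$$ *)

(* Defs.v *)
From mathcomp Require Import all_boot all_order all_algebra perm.
From mathcomp Require Import boolp classical_sets functions cardinality fsbigop.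

Set Implicit Arguments.
Unset Strict Implicit.
Unset Printing Implicit Defensive.

Import GRing.Theory.

Local Open Scope classical_set_scope.
Local Open Scope ring_scope.

(* A Z-graded vector space: a vector space that is the direct sum of the images
   of the projections [gproj i], i : int. *)
Record gradedSpace (K : fieldType) := GradedSpace {
  gcarrier :> lmodType K;
  gproj : int -> {linear gcarrier -> gcarrier};
  gproj_ortho : forall i j x,
    gproj i (gproj j x) = if i == j then gproj j x else 0;
  gproj_sum : forall x, exists2 s : seq int,
    uniq s & x = \sum_(i <- s) gproj i x
}.

Definition homog (K : fieldType) (V : gradedSpace K) (i : int) (x : V) : Prop :=
  gproj V i x = x.

Definition homog_family (K : fieldType) (V : gradedSpace K) (n : nat)
    (d : 'I_n -> int) (x : 'I_n -> V) : Prop :=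
  forall k, homog (d k) (x k).

(* [shuffle [:: i_1; ...; i_k] s], for i_1 + ... + i_k = n: the one-line notation
   of s is increasing on each of the consecutive blocks of lengths i_1, ..., i_k. *)
Definition shuffle (n : nat) (I : seq nat) (s : 'S_n) : bool :=
  all (sorted ltn) (reshape I (codom (fun k => s k : nat))).

(* v_0 ... v_(n-1) = koszul K d s *: v_(s 0) ... v_(s (n-1)) in the graded
   symmetric algebra, for v_k of degree d k: each pair of factors whose order is
   reversed contributes its commutation sign. *)
Definition koszul (K : fieldType) (n : nat) (d : 'I_n -> int) (s : 'S_n) : K :=
  \prod_(a < n) \prod_(b < n | (a < b)%N && (s b < s a)%N)
    (-1) ^ (d (s a) * d (s b)).

(* A family (f_k)_k of maps in k vector variables is encoded as a single function
   on sequences, f_k being its restriction to the sequences of length k; likewise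
   a family (f_{p,q}) is a function of two sequences, of lengths p and q.
   A linear map out of S^k(V) is given by its values f [:: x_1; ...; x_k] on the
   products x_1 ... x_k, i.e. by a graded symmetric k-linear map. *)
Definition sym_linear (K : fieldType) (V W : gradedSpace K) (k : nat)
    (f : seq V -> W) : Prop :=
  (forall (s t : seq V) (a : K) (x y : V), (size s + size t).+1 = k ->
     f (s ++ (a *: x + y) :: t) = a *: f (s ++ x :: t) + f (s ++ y :: t)) /\
  (forall (s t : seq V) (i j : int) (x y : V), (size s + size t).+2 = k ->
     homog i x -> homog j y ->
     f (s ++ x :: y :: t) = (-1) ^ (i * j) *: f (s ++ y :: x :: t)).

(* f_k is a linear map S^k(V) -> W of degree 1. *)
Definition sym_map1 (K : fieldType) (V W : gradedSpace K) (k : nat)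
    (f : seq V -> W) : Prop :=
  sym_linear k f /\
  (forall (d : 'I_k -> int) (x : 'I_k -> V), homog_family d x ->
     homog (\sum_i d i + 1) (f (codom x))).

(* f_{p,q} is a linear map S^p(U) (x) S^q(V) -> W of degree 1. *)
Definition sym_bimap1 (K : fieldType) (U V W : gradedSpace K) (p q : nat)
    (f : seq U -> seq V -> W) : Prop :=
  [/\ forall ys, size ys = q -> sym_linear p (fun xs => f xs ys),
      forall xs, size xs = p -> sym_linear q (f xs)
    & forall (d : 'I_p -> int) (x : 'I_p -> U) (e : 'I_q -> int) (y : 'I_q -> V),
        homog_family d x -> homog_family e y ->
        homog (\sum_i d i + \sum_j e j + 1) (f (codom x) (codom y))].

Definition Linfty (K : fieldType) (V : gradedSpace K) (l : seq V -> V) : Prop :=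
  (forall k, (1 <= k)%N -> sym_map1 k l) /\
  (forall n (d : 'I_n -> int) (x : 'I_n -> V), (1 <= n)%N -> homog_family d x ->
     \sum_(1 <= i < n.+1) \sum_(s : 'S_n | shuffle [:: i; n - i]%N s)
       (let xs := codom (fun k => x (s k)) in
        koszul K d s *: l (l (take i xs) :: drop i xs)) = 0).

(* Only the M_{p,q} with q >= 1 matter here. *)
Definition postLie_infty (K : fieldType) (V : gradedSpace K)
    (M : seq V -> seq V -> V) : Prop :=
  (forall p q, (1 <= q)%N -> sym_bimap1 p q M) /\
  (forall n m (d : 'I_n -> int) (x : 'I_n -> V) (e : 'I_m -> int) (y : 'I_m -> V),
     (1 <= m)%N -> homog_family d x -> homog_family e y ->
     \sum_(0 <= j < n) \sum_(1 <= i < n.+1 | (i + j <= n)%N)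
       \sum_(s : 'S_n | shuffle [:: j; i; n - j - i]%N s)
         (let xs := codom (fun k => x (s k)) in
          koszul K d s *:
            M (M (take j xs) (take i (drop j xs)) :: drop (j + i) xs) (codom y))
     + \sum_(0 <= j < n.+1) \sum_(s : 'S_n | shuffle [:: n - j; j]%N s)
       \sum_(1 <= i < m.+1) \sum_(t : 'S_m | shuffle [:: i; m - i]%N t)
         (let xs := codom (fun k => x (s k)) in
          let ys := codom (fun k => y (t k)) in
          (koszul K d s * koszul K e t
             * (-1) ^ (\sum_(k < n | (k < n - j)%N) d (s k))) *:
            M (take (n - j) xs)
              (M (drop (n - j) xs) (take i ys) :: drop i ys))
     = 0).

Definition open_closed_homotopy_Lie (K : fieldType) (G H : gradedSpace K)
    (l : seq G -> G) (R : seq G -> seq H -> H) : Prop :=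
  [/\ Linfty l,
      forall p q, (1 <= p + q)%N -> sym_bimap1 p q R,
      R [::] [::] = 0
    & forall n m (d : 'I_n -> int) (x : 'I_n -> G)
        (e : 'I_m -> int) (u : 'I_m -> H),
        (1 <= n + m)%N -> homog_family d x -> homog_family e u ->
        \sum_(1 <= i < n.+1) \sum_(s : 'S_n | shuffle [:: i; n - i]%N s)
          (let xs := codom (fun k => x (s k)) in
           koszul K d s *: R (l (take i xs) :: drop i xs) (codom u))
        + \sum_(0 <= i < n.+1) \sum_(0 <= k < m.+1)
          \sum_(s : 'S_n | shuffle [:: i; n - i]%N s)
          \sum_(t : 'S_m | shuffle [:: k; m - k]%N t)
            (let xs := codom (fun a => x (s a)) in
             let us := codom (fun a => u (t a)) in
             (koszul K d s * koszul K e t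
                * (-1) ^ (\sum_(a < n | (a < i)%N) d (s a))) *:
               R (take i xs) (R (drop i xs) (take k us) :: drop k us))
        = 0].

Definition lC_homog (K : fieldType) (V : gradedSpace K) (M : seq V -> seq V -> V)
    (k : nat) (d : 'I_k -> int) (x : 'I_k -> V) : V :=
  \sum_(0 <= j < k) \sum_(s : 'S_k | shuffle [:: j; k - j]%N s)
    let xs := codom (fun a => x (s a)) in
    koszul K d s *: M (take j xs) (drop j xs).

(* The formula for l^C_k involves the degrees of its arguments; for arbitrary
   arguments it is extended multilinearly, by decomposing each argument into its
   homogeneous components (finitely many terms are nonzero), see [lCE]. *)
Definition lC (K : fieldType) (V : gradedSpace K) (M : seq V -> seq V -> V)
    (xs : seq V) : V :=
  \sum_(d \in [set: {ffun 'I_(size xs) -> int}])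
    lC_homog M d (fun a => gproj V (d a) xs`_a).

(* The family M extended by M_{p,0} = 0. *)
Definition zero_extend (K : fieldType) (V : gradedSpace K)
    (M : seq V -> seq V -> V) (xs ys : seq V) : V :=
  if ys is [::] then 0 else M xs ys.

Lemma sym_linear0 (K : fieldType) (V W : gradedSpace K) k (f : seq V -> W) xs :
  sym_linear k f -> size xs = k -> 0 \in xs -> f xs = 0.
Proof.
move=> [flin _] sz /splitPr xs0; case: xs0 sz => s t sz.
have := flin s t (-1) 0 0; rewrite scaler0 addr0 scaleN1r addNr.
by apply; rewrite -sz size_cat /= addnS.
Qed.

Lemma lC_homog0 (K : fieldType) (V : gradedSpace K) (M : seq V -> seq V -> V)
    k (d : 'I_k -> int) (x : 'I_k -> V) (a : 'I_k) :
  (forall p q, (1 <= q)%N -> sym_bimap1 p q M) -> x a = 0 ->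
  lC_homog M d x = 0.
Proof.
move=> HM xa0; rewrite /lC_homog big_nat big1 // => j /andP[_ jk].
rewrite big1 // => s _; lazy zeta; set xs := codom (fun a0 => x (s a0)).
have szxs : size xs = k by rewrite size_codom card_ord.
have [|Ml Mr _] := HM j (k - j)%N; first by rewrite subn_gt0.
have szt : size (take j xs) = j by rewrite size_take szxs jk.
have szd : size (drop j xs) = (k - j)%N by rewrite size_drop szxs.
have : 0 \in take j xs ++ drop j xs.
  by rewrite cat_take_drop; apply/codomP; exists ((s^-1)%g a); rewrite permKV.
rewrite mem_cat => /orP[] x0.
  by rewrite [M _ _](sym_linear0 (Ml _ szd) szt x0) scaler0.
by rewrite (sym_linear0 (Mr _ szt) szd x0) scaler0.
Qed.

Lemma lCE (K : fieldType) (V : gradedSpace K) (M : seq V -> seq V -> V)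
    (xs : seq V) (d : 'I_(size xs) -> int) :
  (forall p q, (1 <= q)%N -> sym_bimap1 p q M) ->
  homog_family d (fun a => xs`_a) ->
  lC M xs = lC_homog M d (fun a => xs`_a).
Proof.
move=> HM hd; have -> : d = [ffun a => d a] by apply/funext => a; rewrite ffunE.
set d' := [ffun a => d a].
have -> : (fun a : 'I_(size xs) => xs`_a) = (fun a => gproj V (d' a) xs`_a).
  by apply/funext => a; rewrite ffunE hd.
rewrite /lC -(@fsbig_set1 _ _ +%R _ d' (fun e : {ffun 'I_(size xs) -> int} =>
  lC_homog M e (fun a => gproj V (e a) xs`_a))).
apply/esym/fsbig_widen => // e [_ /= ne].
suff [a ea] : exists a, e a != d a.
  by apply: (@lC_homog0 _ _ _ _ _ _ a) => //; rewrite -hd gproj_ortho (negbTE ea).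
apply: contrapT => /forallNP ea; apply: ne; apply/ffunP => a.
by rewrite ffunE; apply/eqP; case: eqP (ea a).
Qed.

(* Main.v *)
(** Give products of homogeneous elements their Koszul signs and write Delta for
    the unshuffle coproduct on finite sequences of homogeneous elements; it is
    coassociative and graded cocommutative.  A signed sum over shuffles is an
    evaluation of an iterated Delta, so each of the three families of relations
    becomes an identity between such evaluations.  Let rel(X, Y) be the left-hand
    side of the post-Lie_infinity relation, X and Y being the two groups of
    arguments.  Since M_{p,0} = 0, the open-closed relation is exactly
    rel(X, Y) = 0, and it is void when Y is empty.  By coassociativity and
    cocommutativity the L_infinity relation of l^C on S is the sum of rel(X, Y)
    over the unshuffles of S into X and Y, so it follows from the others. *)
Require Import Defs.
From mathcomp Require Import all_boot all_algebra.
From mathcomp Require Import perm zify ring boolp classical_sets fsbigop.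

Set Implicit Arguments.
Unset Strict Implicit.
Unset Printing Implicit Defensive.

Import GRing.Theory.

(** * The signed unshuffle coproduct on words of graded letters *)

Section UnshuffleSum.
Local Open Scope ring_scope.
Variables (K : fieldType) (A : eqType).
Implicit Types (W : lmodType K) (t : int * A) (s a b c : seq (int * A)).

Notation sgn z := ((-1 : K) ^ (z : int)).

Lemma sgnD (y z : int) : sgn (y + z) = sgn y * sgn z.
Proof. by rewrite expfzDr // oppr_eq0 oner_eq0. Qed.

Lemma sgn_sqr (z : int) : sgn z * sgn z = 1.
Proof. by rewrite -expfzMl mulrNN mulr1 exp1rz. Qed.

Lemma sgn_eq (y z w : int) : y = z + (w + w) -> sgn y = sgn z.
Proof. by move->; rewrite !sgnD sgn_sqr mulr1. Qed.

Definition deg s : int := \sum_(t <- s) t.1.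

Lemma deg_nil : deg [::] = 0. Proof. exact: big_nil. Qed.

Lemma deg_cons t s : deg (t :: s) = t.1 + deg s.
Proof. exact: big_cons. Qed.

Lemma deg_cat a b : deg (a ++ b) = deg a + deg b.
Proof. exact: big_cat. Qed.

Lemma perm_deg a b : perm_eq a b -> deg a = deg b.
Proof. exact: perm_big. Qed.

(* F evaluated on the unshuffle coproduct of s; the sign moves t across a. *)
Fixpoint unsh W s (F : seq (int * A) -> seq (int * A) -> W) : W :=
  if s is t :: s' then
    unsh s' (fun a b => F (t :: a) b + sgn (t.1 * deg a) *: F a (t :: b))
  else F [::] [::].

(** Only pairs of blocks that together rearrange [s] are ever fed to [F], so the length, degree and
    homogeneity of [s] are available in the comparison. *)
Lemma eq_unsh W s (F G : seq (int * A) -> seq (int * A) -> W) :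
  (forall a b, perm_eq (a ++ b) s -> F a b = G a b) -> unsh s F = unsh s G.
Proof.
elim: s F G => [|t s IH] F G eqFG /=; first exact: eqFG.
apply: IH => a b ab; rewrite !eqFG //= ?perm_cons //.
by rewrite perm_catC /= perm_cons perm_catC.
Qed.

Lemma unsh0 W s : unsh s (fun _ _ => 0 : W) = 0.
Proof.
by elim: s => //= t s IH; rewrite -[RHS]IH; apply: eq_unsh => a b _; rewrite scaler0 addr0.
Qed.

Lemma unshD W s (F G : seq (int * A) -> seq (int * A) -> W) :
  unsh s (fun a b => F a b + G a b) = unsh s F + unsh s G.
Proof.
elim: s F G => //= t s IH F G; rewrite -IH; apply: eq_unsh => a b _.
by rewrite scalerDr addrACA.
Qed.

Lemma unsh_sum W (I : Type) (r : seq I) (P : pred I) s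
    (F : I -> seq (int * A) -> seq (int * A) -> W) :
  unsh s (fun a b => \sum_(i <- r | P i) F i a b) = \sum_(i <- r | P i) unsh s (F i).
Proof.
elim: r => [|i r IH]; first by rewrite big_nil -[RHS](unsh0 W s); apply: eq_unsh => *; rewrite big_nil.
rewrite big_cons -IH; case: ifP => Pi; last by apply: eq_unsh => *; rewrite big_cons Pi.
by rewrite -unshD; apply: eq_unsh => *; rewrite big_cons Pi.
Qed.

Lemma linear_unsh W W' (f : W -> W') s F :
  linear f -> f (unsh s F) = unsh s (fun a b => f (F a b)).
Proof.
move=> flin; elim: s F => //= t s IH F; rewrite IH; apply: eq_unsh => a b _.
by rewrite addrC flin addrC.
Qed.

Lemma unshZ W s k (F : seq (int * A) -> seq (int * A) -> W) :
  unsh s (fun a b => k *: F a b) = k *: unsh s F.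
Proof.
rewrite [RHS](@linear_unsh _ _ (fun w => k *: w)) // => a x y.
by rewrite scalerDr !scalerA mulrC.
Qed.

(** The head letter may enter any of the three blocks; its sign for crossing two of them factors
    because the degree of [ab] is the sum of those of [a] and [b]. *)
Lemma unsh_coassoc W s (F : seq _ -> seq _ -> seq _ -> W) :
  unsh s (fun ab c => unsh ab (fun a b => F a b c)) =
  unsh s (fun a bc => unsh bc (fun b c => F a b c)).
Proof.
elim: s F => //= t s IH F.
under eq_unsh => ab c _ do rewrite -unshZ -unshD.
under [RHS]eq_unsh => a bc _ do rewrite -unshZ -unshD.
rewrite -IH; apply: eq_unsh => ab c _; apply: eq_unsh => a b /perm_deg abE.
by rewrite -abE deg_cat mulrDr sgnD scalerDr scalerA addrA.
Qed.

(** Graded cocommutativity: whichever block receives the head letter, the exponents on the two sides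
    differ by an even integer. *)
Lemma unsh_swap W s (F : seq _ -> seq _ -> W) :
  unsh s F = unsh s (fun a b => sgn (deg a * deg b) *: F b a).
Proof.
elim: s F => [|t s IH] F /=; first by rewrite deg_nil mul0r expr0z scale1r.
rewrite [RHS]IH; apply: eq_unsh => a b _; rewrite !deg_cons scalerDr !scalerA addrC.
congr (_ *: _ + _); first by rewrite -sgnD; apply: (@sgn_eq _ _ (- (deg a * deg b))); ring.
rewrite -!sgnD (@sgn_eq _ 0 (deg a * deg b + t.1 * deg b)) ?expr0z ?scale1r //; ring.
Qed.

(** When [x] and [y] fall in the same block, the symmetry of [F] gives the sign; when they are
    separated, one crossing the other gives it. A letter of [p] only sees the sum of their degrees,
    so its sign is unaffected by the exchange. *)
Lemma unsh_exchange W (x y : int * A) p q (F : seq _ -> seq _ -> W) :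
  (forall a a' b, F (a ++ x :: y :: a') b = sgn (x.1 * y.1) *: F (a ++ y :: x :: a') b) ->
  (forall a b b', F a (b ++ x :: y :: b') = sgn (x.1 * y.1) *: F a (b ++ y :: x :: b')) ->
  unsh (p ++ x :: y :: q) F = sgn (x.1 * y.1) *: unsh (p ++ y :: x :: q) F.
Proof.
elim: p F => [|t p IH] F Fl Fr /=.
  rewrite -unshZ; apply: eq_unsh => a b _; rewrite !deg_cons.
  rewrite (Fl [::]) (Fr _ [::]) !scalerDr !scalerA -!addrA; congr (_ + _).
  rewrite addrCA -!sgnD; congr (_ *: _ + (_ *: _ + _ *: _)); last by congr (sgn _); ring.
    by apply: (@sgn_eq _ _ (- (x.1 * y.1))); ring.
  by congr (sgn _); ring.
apply: IH => a b c; rewrite scalerDr !scalerA [sgn (x.1 * _) * _]mulrC -!scalerA.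
  by rewrite (Fl (t :: a)) Fl !deg_cat !deg_cons [y.1 + (x.1 + _)]addrCA.
by rewrite (Fr _ (t :: b)) Fr.
Qed.

(** Letters in [A] cannot be added, so linearity is expressed by the values of [F] on three letters;
    their equal degrees make the Koszul signs coincide. *)
Lemma unsh_lin_slot W (k : K) (t t1 t2 : int * A) p q (F : seq _ -> seq _ -> W) :
  t1.1 = t.1 -> t2.1 = t.1 ->
  (forall a a' b, F (a ++ t :: a') b = k *: F (a ++ t1 :: a') b + F (a ++ t2 :: a') b) ->
  (forall a b b', F a (b ++ t :: b') = k *: F a (b ++ t1 :: b') + F a (b ++ t2 :: b')) ->
  unsh (p ++ t :: q) F = k *: unsh (p ++ t1 :: q) F + unsh (p ++ t2 :: q) F.
Proof.
move=> t1E t2E; elim: p F => [|u p IH] F Fl Fr /=.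
  rewrite -unshZ -unshD; apply: eq_unsh => a b _.
  rewrite (Fl [::]) (Fr _ [::]) t1E t2E !scalerDr !scalerA mulrC.
  by rewrite -!addrA; congr (_ + _); rewrite addrCA.
apply: IH => a b c.
  rewrite (Fl (u :: a)) Fl !deg_cat !deg_cons t1E t2E !scalerDr !scalerA mulrC.
  by rewrite -!addrA; congr (_ + _); rewrite addrCA.
rewrite (Fr _ (u :: b)) Fr !scalerDr !scalerA mulrC.
by rewrite -!addrA; congr (_ + _); rewrite addrCA.
Qed.

Definition unsh3 W s (F : seq _ -> seq _ -> seq _ -> W) : W :=
  unsh s (fun ab c => unsh ab (fun a b => F a b c)).

Lemma unsh3_cons W t s (F : seq _ -> seq _ -> seq _ -> W) :
  unsh3 (t :: s) F =
  unsh3 s (fun a b c => F (t :: a) b c + sgn (t.1 * deg a) *: F a (t :: b) c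
             + sgn (t.1 * deg (a ++ b)) *: F a b (t :: c)).
Proof.
rewrite /unsh3 /=; apply: eq_unsh => ab c _; rewrite -unshZ -unshD.
by apply: eq_unsh => a b /perm_deg ->.
Qed.

Lemma eq_unsh3 W s (F G : seq _ -> seq _ -> seq _ -> W) :
  (forall a b c, perm_eq (a ++ b ++ c) s -> F a b c = G a b c) -> unsh3 s F = unsh3 s G.
Proof.
move=> FG; apply: eq_unsh => ab c abc; apply: eq_unsh => a b ab'; apply: FG.
by rewrite catA; apply: perm_trans abc; rewrite perm_cat2r.
Qed.

Lemma unsh3D W s (F G : seq _ -> seq _ -> seq _ -> W) :
  unsh3 s (fun a b c => F a b c + G a b c) = unsh3 s F + unsh3 s G.
Proof. by rewrite /unsh3 -unshD; apply: eq_unsh => a b _; rewrite -unshD. Qed.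

Lemma unsh3_0 W s : unsh3 s (fun _ _ _ => 0 : W) = 0.
Proof. by rewrite /unsh3; under eq_unsh do rewrite unsh0; rewrite unsh0. Qed.

End UnshuffleSum.

(** * Inserting a letter into a word, and when the blocks stay increasing *)

Section Insertion.
Variables (T : Type) (x : T).
Implicit Types (l : seq T).

Definition insert p l := take p l ++ x :: drop p l.

Lemma take_insert_le i p l : p <= i -> take i.+1 (insert p l) = insert p (take i l).
Proof.
rewrite /insert; elim: p i l => [|p IH] i l; first by rewrite !take0 !drop0.
by case: l => [|y l]; case: i => //= i pi; rewrite IH.
Qed.

Lemma drop_insert_le i p l : p <= i -> p <= size l -> drop i.+1 (insert p l) = drop i l.
Proof.
rewrite /insert; elim: p i l => [|p IH] i l; first by rewrite take0 drop0.
by case: l => [|y l] //; case: i => // i pi pl /=; apply: IH.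
Qed.

Lemma take_insert_ge i p l : i <= p -> p <= size l -> take i (insert p l) = take i l.
Proof.
rewrite /insert; elim: i p l => [|i IH] p l; first by rewrite !take0.
by case: l => [|y l]; case: p => // p pi pl /=; rewrite IH.
Qed.

Lemma drop_insert_ge i p l :
  i <= p -> p <= size l -> drop i (insert p l) = insert (p - i) (drop i l).
Proof.
rewrite /insert; elim: i p l => [|i IH] p l; first by rewrite !drop0 subn0.
by case: l => [|y l]; case: p => //= p pi pl; rewrite IH.
Qed.

End Insertion.

(** The inserted 0 is strictly below every shifted letter, so it can only stand in front. *)
Lemma sorted_insert0 p (l : seq nat) : p <= size l ->
  sorted ltn (insert 0 p (map succn l)) = (p == 0) && sorted ltn l.
Proof.
have sortedS : sorted ltn (map succn l) = sorted ltn l by rewrite sorted_map.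
rewrite /insert; case: p => [|p] pl.
  rewrite take0 drop0 /= -sortedS path_sortedE; last exact: ltn_trans.
  by rewrite all_map; apply/andb_idl => _; apply/allP.
case: l pl {sortedS} => // y l _ /=; apply/negP.
rewrite path_sortedE; last exact: ltn_trans.
by case/andP; rewrite all_cat => /andP[_ /andP[]].
Qed.

Definition sorted3 i j k (l : seq nat) :=
  [&& sorted ltn (take i l), sorted ltn (take j (drop i l))
    & sorted ltn (take k (drop j (drop i l)))].

(** The minimum 0 has to open one of the three blocks. Since that block is nonempty, the three cases
    are mutually exclusive, which later turns the disjunction into a sum. *)
Lemma sorted3_insert i j k p (l : seq nat) :
  i + j + k = (size l).+1 -> p <= size l ->
  sorted3 i j k (insert 0 p (map succn l)) =
  [|| [&& 0 < i, p == 0 & sorted3 i.-1 j k l],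
      [&& 0 < j, p == i & sorted3 i j.-1 k l]
    | [&& 0 < k, p == i + j & sorted3 i j k.-1 l]].
Proof.
have sortedS m : sorted ltn (map succn m) = sorted ltn m by rewrite sorted_map.
move=> ijk pl; rewrite /sorted3.
have [pi|ip] := ltnP p i.
  case: i ijk pi => // i ijk pi; rewrite take_insert_le // drop_insert_le ?size_map //.
  rewrite -map_take -!map_drop -!map_take !sortedS sorted_insert0; last by rewrite size_take_min; lia.
  have -> : (p == i.+1) = false by lia.
  have -> : (p == i.+1 + j) = false by lia.
  by rewrite /= !andbF !orbF -!andbA.
rewrite take_insert_ge ?[drop i (insert _ _ _)]drop_insert_ge ?size_map //.
rewrite -map_take -map_drop sortedS.
have /negbTE i0 : ~~ ((0 < i) && (p == 0)) by lia.
have [pj|jp] := ltnP p (i + j).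
  case: j ijk pj => [|j] ijk pj; first by exfalso; lia.
  rewrite take_insert_le ?drop_insert_le ?size_map ?size_drop; [|lia ..].
  rewrite -map_take -map_drop -map_take sortedS sorted_insert0; last by rewrite size_take_min size_drop; lia.
  rewrite subn_eq0.
  have -> : (p == i + j.+1) = false by lia.
  have -> : (p <= i) = (p == i) by lia.
  rewrite [in RHS]andbA i0 /= andbF orbF -andbA.
  by case: (p == i); rewrite ?andbF.
rewrite take_insert_ge ?drop_insert_ge ?size_map ?size_drop; [|lia ..].
rewrite -map_take -map_drop sortedS.
case: k ijk => [|k] ijk; first by exfalso; lia.
rewrite take_insert_le; last lia.
rewrite -map_take sorted_insert0; last by rewrite size_take_min !size_drop; lia.
have -> : (p - i - j == 0) = (p == i + j) by lia.
have /negbTE j0 : ~~ ((0 < j) && (p == i)) by lia.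
rewrite [in RHS]andbA i0 /= [in RHS]andbA j0 /=.
by case: (p == _); rewrite ?andbF.
Qed.

(** * Sums over shuffle permutations as unshuffle sums *)

Section ShuffleSum.
Local Open Scope ring_scope.
Variables (K : fieldType) (A : eqType) (W : lmodType K).
Notation sgn z := ((-1 : K) ^ (z : int)).

Lemma nth_codom_ord (B : Type) (x0 : B) n (f : 'I_n -> B) (i : 'I_n) :
  nth x0 (codom f) i = f i.
Proof. by rewrite codomE (nth_map i) ?size_enum_ord ?nth_ord_enum. Qed.

Lemma size_codom_ord (B : Type) n (f : 'I_n -> B) : size (codom f) = n.
Proof. by rewrite size_codom card_ord. Qed.

Lemma codom_map (B C : Type) (g : B -> C) n (f : 'I_n -> B) :
  codom (fun k => g (f k)) = map g (codom f).
Proof. by rewrite !codomE -map_comp. Qed.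

Lemma codom_lift (B : Type) n (p : 'I_n.+1) (f : 'I_n.+1 -> B)
    (l := codom (fun k => f (lift p k))) :
  codom f = take p l ++ f p :: drop p l.
Proof.
have szl : size l = n by rewrite size_codom_ord.
have szt : size (take p l) = p by rewrite size_takel // szl -ltnS.
apply: (@eq_from_nth _ (f p)) => [|i].
  by rewrite size_cat /= szt size_drop szl size_codom_ord; have := ltn_ord p; lia.
rewrite size_codom_ord => ltin; rewrite -[i]/(val (Ordinal ltin)) nth_codom_ord nth_cat szt.
case: (unliftP p (Ordinal ltin)) => [k|] ->; last by rewrite ltnn subnn.
rewrite /= /bump; case: (leqP p k) => pk; last by rewrite add0n pk nth_take // nth_codom_ord.
rewrite add1n ltnNge leqW //=.
by rewrite subSn //= nth_drop subnKC // nth_codom_ord.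
Qed.

(* p is the position of 0 in the one-line notation. *)
Lemma sum_lift_perm n (P : pred 'S_n.+1) (F : 'S_n.+1 -> W) :
  \sum_(s | P s) F s =
  \sum_(p < n.+1) \sum_(s : 'S_n | P (lift_perm p ord0 s)) F (lift_perm p ord0 s).
Proof.
pose h (ps : 'I_n.+1 * 'S_n) := lift_perm ps.1 ord0 ps.2.
have h_inj : injective h.
  move=> [p s] [q t] /permP /= eq_h.
  have pq : p = q.
    by apply: (@perm_inj _ (lift_perm q ord0 t)); rewrite -eq_h /= !lift_perm_id.
  congr (_, _); first exact: pq.
  apply/permP => k; apply: (@lift_inj _ ord0).
  by have := eq_h (lift p k); rewrite pq /= !lift_perm_lift.
have h_bij : bijective h.
  by apply: inj_card_bij h_inj _; rewrite card_prod card_ord !card_Sn factS.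
rewrite (reindex h); last exact: onW_bij.
by rewrite pair_big_dep.
Qed.

(** The smallest index 0, placed at position [p], is inverted exactly with the [p] letters before
    it; the remaining inversions are those of [s]. *)
Lemma koszul_lift_perm n (d : 'I_n.+1 -> int) (p : 'I_n.+1) (s : 'S_n) :
  koszul K d (lift_perm p ord0 s) =
  sgn (d ord0 * \sum_(a < n | (a < p)%N) d (lift ord0 (s a)))
    * koszul K (fun k => d (lift ord0 k)) s.
Proof.
rewrite /koszul (bigD1_ord p (P := xpredT)) //= big1 ?mul1r; last first.
  by move=> b; rewrite lift_perm_id ltn0 andbF.
have -> : sgn (d ord0 * \sum_(a < n | (a < p)%N) d (lift ord0 (s a))) =
    \prod_(a < n | (a < p)%N) sgn (d (lift ord0 (s a)) * d ord0).
  elim/big_rec2: _ => [|a y z _ <-]; first by rewrite mulr0 expr0z.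
  by rewrite mulrDr sgnD [d ord0 * _]mulrC.
rewrite [X in X * _]big_mkcond -big_split /=; apply: eq_bigr => a _.
rewrite lift_perm_lift (big_mkcond (fun b => _ && _)) (bigD1_ord p (P := xpredT)) //=.
rewrite lift_perm_id andbT; congr (_ * _).
  by congr (if _ then _ else _); rewrite /bump; case: (leqP p a); lia.
rewrite [RHS]big_mkcond; apply: eq_bigr => b _; rewrite lift_perm_lift.
congr (if _ then _ else _); rewrite /= /bump !leq0n !add1n !ltnS; congr (_ && _).
by case: (leqP p a); case: (leqP p b); lia.
Qed.

Lemma deg_take_codom n (f : 'I_n -> int * A) p :
  deg (take p (codom f)) = \sum_(a < n | (a < p)%N) (f a).1.
Proof.
elim: n f p => [|n IH] f p; first by rewrite big_ord0 (size0nil (size_codom_ord f)) deg_nil.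
rewrite (codom_lift ord0) /= take0 drop0 /= big_mkcond big_ord_recl -big_mkcond /=.
case: p => [|p] /=; first by rewrite deg_nil big1.
by rewrite deg_cons IH.
Qed.


Lemma shuffle_lift_perm n (i j k : nat) (p : 'I_n.+1) (s : 'S_n) :
  (i + j + k = n.+1)%N ->
  shuffle [:: i; j; k] (lift_perm p ord0 s) =
  [|| [&& 0 < i, p == 0 :> nat & shuffle [:: i.-1; j; k] s],
      [&& 0 < j, p == i :> nat & shuffle [:: i; j.-1; k] s]
    | [&& 0 < k, p == i + j :> nat & shuffle [:: i; j; k.-1] s]]%N.
Proof.
have shE (m i' j' k' : nat) (u : 'S_m) :
    shuffle [:: i'; j'; k'] u = sorted3 i' j' k' (codom (fun a => u a : nat)).
  by rewrite /shuffle /= andbT.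
move=> ijk; have pn : (p <= n)%N by rewrite -ltnS.
rewrite !shE -sorted3_insert ?size_codom_ord //.
rewrite (codom_lift p) lift_perm_id; congr (sorted3 _ _ _ (insert _ _ _)).
rewrite -codom_map; apply: eq_codom => a /=; by rewrite lift_perm_lift.
Qed.

Lemma sum_ord_eq n q (b : bool) (X : nat -> W) : (b -> q <= n)%N ->
  \sum_(p < n.+1) (if b && (p == q :> nat) then X p else 0) = if b then X q else 0.
Proof.
case: b => qn /=; last exact: big1.
by rewrite -big_mkcond (big_pred1 (Ordinal (qn isT : (q < n.+1)%N))).
Qed.

(** Induction through the position of the index 0 in the one-line notation: it opens one of the
    blocks, and the three possibilities match the three terms of [unsh3_cons]. *)
Lemma shuffle3_sumE n (f : 'I_n -> int * A) (i j k : nat) (F : seq _ -> seq _ -> seq _ -> W) :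
  (i + j + k = n)%N ->
  \sum_(s : 'S_n | shuffle [:: i; j; k] s)
     (let l := codom (fun a => f (s a)) in
      koszul K (fun a => (f a).1) s *: F (take i l) (take j (drop i l)) (drop (i + j) l)) =
  unsh3 (codom f) (fun a b c => if (size a == i) && (size b == j) then F a b c else 0).
Proof.
elim: n f i j k F => [|n IH] f i j k F.
  move=> /eqP; rewrite !addn_eq0 -andbA => /and3P[/eqP -> /eqP -> /eqP ->].
  rewrite (size0nil (size_codom_ord f)) /unsh3 /=.
  rewrite (big_pred1 (1%g : 'S_0)) => [|s]; last first.
    have -> : s = 1%g by apply/permP => -[].
    by rewrite [RHS]eqxx /shuffle /= !(size0nil (size_codom_ord _)).
  by rewrite (size0nil (size_codom_ord _)) /koszul big_ord0 scale1r.
move=> ijk; rewrite sum_lift_perm.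
set t := f ord0; pose g k := f (lift ord0 k).
pose L (s : 'S_n) := codom (fun a => g (s a)).
pose kos (s : 'S_n) := koszul K (fun a => (g a).1) s.
(* [X1], [X2], [X3] are the contributions in which [t] opens the first, second or third block,
   signed by the degrees of the letters it crosses. *)
pose X1 s := kos s *: F (t :: take i.-1 (L s)) (take j (drop i.-1 (L s))) (drop (i.-1 + j) (L s)).
pose X2 s := kos s *: (sgn (t.1 * deg (take i (L s))) *:
  F (take i (L s)) (t :: take j.-1 (drop i (L s))) (drop (i + j.-1) (L s))).
pose X3 s := kos s *: (sgn (t.1 * deg (take i (L s) ++ take j (drop i (L s)))) *:
  F (take i (L s)) (take j (drop i (L s))) (t :: drop (i + j) (L s))).
have term (p : 'I_n.+1) s :
    (if shuffle [:: i; j; k] (lift_perm p ord0 s) then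
       let l := codom (fun a => f (lift_perm p ord0 s a)) in
       koszul K (fun a => (f a).1) (lift_perm p ord0 s)
         *: F (take i l) (take j (drop i l)) (drop (i + j) l) else 0) =
    (if (0 < i)%N && shuffle [:: i.-1; j; k] s && (p == 0 :> nat) then X1 s else 0) +
    (if (0 < j)%N && shuffle [:: i; j.-1; k] s && (p == i :> nat) then X2 s else 0) +
    (if (0 < k)%N && shuffle [:: i; j; k.-1] s && (p == i + j :> nat)%N then X3 s else 0).
  rewrite (shuffle_lift_perm p s ijk) /= koszul_lift_perm -/(kos s).
  have -> : codom (fun a => f (lift_perm p ord0 s a)) = insert t p (L s).
    rewrite (codom_lift p) lift_perm_id; congr (insert _ _ _).
    by apply: eq_codom => a; rewrite lift_perm_lift.
  rewrite -(deg_take_codom (fun a => g (s a))) -/t -/(L s) {}/X1 {}/X2 {}/X3.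
  have szL : size (L s) = n := size_codom_ord _.
  have pL : (p <= size (L s))%N by rewrite szL -ltnS.
  clearbody t; rewrite -!scalerA ![_ && _ && (_ == _)]andbAC -!andbA.
  have [pi|ip] := ltnP p i.
    case: i ijk pi => // i ijk pi.
    have -> : (nat_of_ord p == i.+1) = false by lia.
    have -> : (nat_of_ord p == i.+1 + j)%N = false by lia.
    rewrite !andbF /= ?andbF ?orbF ?addr0; case: eqP => //= p0; case: ifP => // _.
    rewrite p0 take0 deg_nil mulr0 expr0z scale1r.
    by rewrite take_insert_le ?drop_insert_le // /insert take0 drop0.
  have /negbTE i0 : ~~ ((0 < i) && (nat_of_ord p == 0))%N by lia.
  rewrite ![(0 < i)%N && _]andbA i0 /= add0r.
  have [pj|jp] := ltnP p (i + j).
    case: j ijk pj => [|j] ijk pj; first by exfalso; lia.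
    have -> : (nat_of_ord p == i + j.+1)%N = false by lia.
    rewrite !andbF /= ?andbF ?orbF ?addr0; case: eqP => //= pE; case: ifP => // _.
    rewrite pE in pL *; rewrite take_insert_ge // [drop i (insert _ _ _)]drop_insert_ge //.
    rewrite subnn addnS drop_insert_le ?leq_addr // /insert take0 drop0 /=.
    by rewrite !scalerA mulrC.
  have /negbTE j0 : ~~ ((0 < j) && (nat_of_ord p == i))%N by lia.
  rewrite ![(0 < j)%N && _]andbA j0 /= add0r.
  case: k ijk => [|k] ijk; first by exfalso; lia.
  rewrite /=; case: eqP => //= pE; case: ifP => // _.
  rewrite pE in pL jp *.
  have iij : (i <= i + j)%N by rewrite leq_addr.
  rewrite take_insert_ge // [drop i (insert _ _ _)]drop_insert_ge //.
  rewrite [drop (i + j) (insert _ _ _)]drop_insert_ge // addKn subnn.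
  rewrite take_insert_ge ?size_drop ?leq_subRL ?takeD //; last exact: leq_trans pL.
  by rewrite {1}/insert take0 drop0 /= !scalerA mulrC.
under eq_bigr => p _ do rewrite big_mkcond /= (eq_bigr _ (fun s _ => term p s)).
(* For fixed [s], the sum over [p] selects a single admissible position in each of the three
   terms. *)
rewrite exchange_big /=.
have -> : unsh3 (codom f)
     (fun a b c => if (size a == i) && (size b == j) then F a b c else 0) =
   \sum_(s : 'S_n) ((if (0 < i)%N && shuffle [:: i.-1; j; k] s then X1 s else 0) +
     (if (0 < j)%N && shuffle [:: i; j.-1; k] s then X2 s else 0) +
     (if (0 < k)%N && shuffle [:: i; j; k.-1] s then X3 s else 0)); last first.
  apply: eq_bigr => s _; rewrite !big_split /= (sum_ord_eq (fun _ => X1 s)) //.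
  by rewrite (sum_ord_eq (fun _ => X2 s)) ?(sum_ord_eq (fun _ => X3 s)) // => /andP[]; lia.
rewrite !big_split /= (codom_lift ord0) take0 drop0 /= unsh3_cons !unsh3D.
congr (_ + _ + _).
(* An empty block cannot receive [t], and both sides vanish; otherwise the induction hypothesis
   applies with [t] absorbed into [F]. *)
- case: i ijk @X1 @X2 @X3 {term} => [|i] ijk X1 X2 X3 /=.
    by rewrite big1 // -[LHS]/(unsh3 _ (fun _ _ _ => 0)) unsh3_0.
  by rewrite -big_mkcond; apply/esym/(IH g i j k (fun a b c => F (t :: a) b c)); lia.
- case: j ijk @X1 @X2 @X3 {term} => [|j] ijk X1 X2 X3 /=.
    rewrite big1 // -[RHS](unsh3_0 W (codom g)); apply: eq_unsh3 => a b c _.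
    by rewrite andbF scaler0.
  rewrite -big_mkcond; apply: etrans (esym (IH g i j k
    (fun a b c => sgn (t.1 * deg a) *: F a (t :: b) c) _)); last lia.
  by apply: eq_unsh3 => a b c _; case: ifP; rewrite ?scaler0.
- case: k ijk @X1 @X2 @X3 {term} => [|k] ijk X1 X2 X3 /=.
    (* With [k = 0], the first two blocks would need [n.+1] letters while only [n] remain. *)
    rewrite big1 // -[RHS](unsh3_0 W (codom g)); apply: eq_unsh3 => a b c /perm_size.
    rewrite !size_cat size_codom_ord => abc.
    by rewrite ifF ?scaler0 //; apply/negP => /andP[/eqP ai /eqP bj]; move: abc; rewrite ai bj; lia.
  rewrite -big_mkcond; apply: etrans (esym (IH g i j k
    (fun a b c => sgn (t.1 * deg (a ++ b)) *: F a b (t :: c)) _)); last lia.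
  by apply: eq_unsh3 => a b c _; case: ifP; rewrite ?scaler0.
Qed.
End ShuffleSum.

(** * Shuffle sums over all block lengths *)

Section AllShuffles.
Local Open Scope ring_scope.
Variables (K : fieldType) (A : eqType) (W : lmodType K).

(** Counit law: only the splitting with empty right block survives, and its sign is 1. *)
Lemma unsh_nilr s (F : seq (int * A) -> seq (int * A) -> W) :
  (forall a t b, F a (t :: b) = 0) -> unsh s F = F s [::].
Proof.
elim: s F => //= t s IH F F0; rewrite IH ?F0 ?scaler0 ?addr0 // => a u b.
by rewrite !F0 scaler0 addr0.
Qed.

Lemma shuffle2_sumE n (f : 'I_n -> int * A) i (F : seq _ -> seq _ -> W) : (i <= n)%N ->
  \sum_(s : 'S_n | shuffle [:: i; n - i]%N s)
     (let l := codom (fun a => f (s a)) in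
      koszul K (fun a => (f a).1) s *: F (take i l) (drop i l)) =
  unsh (codom f) (fun a b => if size a == i then F a b else 0).
Proof.
(* A two-block shuffle is a three-block shuffle with empty last block. *)
move=> ni; have := @shuffle3_sumE K A W n f i (n - i) 0 (fun a b c => F a b).
rewrite addn0 subnKC // => /(_ erefl) E; rewrite (eq_bigl (shuffle [:: i; n - i; 0]%N)); last first.
  by move=> s; rewrite /shuffle /= take0.
transitivity (\sum_(s : 'S_n | shuffle [:: i; n - i; 0]%N s)
     (let l := codom (fun a => f (s a)) in
      koszul K (fun a => (f a).1) s *: F (take i l) (take (n - i) (drop i l)))).
  apply: eq_bigr => s _; rewrite /= [take (n - i) _]take_oversize //.
  by rewrite size_drop size_codom_ord.
rewrite {}E /unsh3.
(* Lengths [i] and [n - i] for the first two blocks leave no letter for [c]. *)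
transitivity (unsh (codom f) (fun ab c => if c is [::] then
    unsh ab (fun a b => if size a == i then F a b else 0) else 0)).
  apply: eq_unsh => ab c /perm_size; rewrite size_cat size_codom_ord => abc.
  case: c abc => [|t c] abc.
    apply: eq_unsh => a b /perm_size; rewrite size_cat => abE.
    by case: eqP => //= ai; rewrite ifT //; apply/eqP; move: abE abc; rewrite ai /=; lia.
  rewrite -[RHS](unsh0 W ab); apply: eq_unsh => a b /perm_size; rewrite size_cat => abE.
  by rewrite ifF //; apply/negP => /andP[/eqP ai /eqP bi]; move: abE abc; rewrite ai bi /=; lia.
by rewrite unsh_nilr.
Qed.

(** Each splitting has exactly one left length, so summing over [i] removes the length condition of
    [shuffle2_sumE]. *)
Lemma all_shuffle2_sumE n (f : 'I_n -> int * A) (F : seq _ -> seq _ -> W) :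
  \sum_(0 <= i < n.+1) \sum_(s : 'S_n | shuffle [:: i; n - i]%N s)
     (let l := codom (fun a => f (s a)) in
      koszul K (fun a => (f a).1) s *: F (take i l) (drop i l)) =
  unsh (codom f) F.
Proof.
rewrite big_nat (eq_bigr _ (fun i ni => @shuffle2_sumE n f i F ni)).
rewrite -unsh_sum; apply: eq_unsh => a b /perm_size; rewrite size_cat size_codom_ord => abn.
have an : (size a < n.+1)%N by rewrite ltnS -abn leq_addr.
by rewrite -big_nat big_mkord -big_mkcond (big_pred1 (Ordinal an)) // => i; rewrite eq_sym.
Qed.

Lemma all_shuffle3_sumE n (f : 'I_n -> int * A) (F : seq _ -> seq _ -> seq _ -> W) :
  \sum_(0 <= j < n.+1) \sum_(0 <= i < n.+1 | (i + j <= n)%N)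
     \sum_(s : 'S_n | shuffle [:: j; i; n - j - i]%N s)
     (let l := codom (fun a => f (s a)) in
      koszul K (fun a => (f a).1) s *: F (take j l) (take i (drop j l)) (drop (j + i) l)) =
  unsh3 (codom f) F.
Proof.
transitivity (\sum_(0 <= j < n.+1) \sum_(0 <= i < n.+1 | (i + j <= n)%N)
    unsh3 (codom f) (fun a b c => if (size a == j) && (size b == i) then F a b c else 0)).
  by apply: eq_bigr => j _; apply: eq_bigr => i ij; apply: shuffle3_sumE; lia.
rewrite /unsh3; under eq_bigr do rewrite -unsh_sum; rewrite -unsh_sum.
apply: eq_unsh => ab c /perm_size; rewrite size_cat size_codom_ord => abn.
under eq_bigr do rewrite -unsh_sum; rewrite -unsh_sum.
apply: eq_unsh => a b /perm_size; rewrite size_cat => abE.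
have abn' : (size a + size b <= n)%N by rewrite -abn -abE leq_addr.
have an : (size a < n.+1)%N by rewrite ltnS (leq_trans _ abn') // leq_addr.
have bn : (size b < n.+1)%N by rewrite ltnS (leq_trans _ abn') // leq_addl.
rewrite big_mkord (bigD1 (Ordinal an)) //= [X in _ + X]big1 ?addr0 => [|j /eqP ja]; last first.
  by rewrite big1 // => i _; case: eqP => // aj; case: ja; apply: val_inj.
rewrite big_mkord (bigD1 (Ordinal bn)) /=; last by rewrite addnC.
rewrite !eqxx big1 ?addr0 // => i /andP[_ /eqP ib].
by case: eqP => //= bi; case: ib; apply: val_inj.
Qed.

End AllShuffles.

(** * The operations M and l^C on words of homogeneous elements *)

Section PostLie.
Local Open Scope ring_scope.
Variables (K : fieldType) (V : gradedSpace K) (M : seq V -> seq V -> V).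
Hypothesis M_deg1 : forall p q : nat, (1 <= q)%N -> sym_bimap1 p q M.
Notation T := (int * V)%type.
Notation Z := (zero_extend M).
Notation sgn z := ((-1 : K) ^ (z : int)).
Implicit Types (s : seq T).

(** Letters carry their degree explicitly: the signs need it, and it cannot be read off the vector,
    since 0 is homogeneous of every degree. *)
Definition vals s : seq V := [seq t.2 | t <- s].

Lemma vals_cat a b : vals (a ++ b) = vals a ++ vals b.
Proof. exact: map_cat. Qed.

Lemma vals_take i s : vals (take i s) = take i (vals s).
Proof. exact: map_take. Qed.

Lemma vals_drop i s : vals (drop i s) = drop i (vals s).
Proof. exact: map_drop. Qed.

Lemma zero_extendE a b : b != [::] -> Z (vals a) (vals b) = M (vals a) (vals b).
Proof. by case: b. Qed.

Lemma zero_extend_nilr a : Z a [::] = 0. Proof. by []. Qed.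

Lemma zero_extend_linl (k : K) u v p q b :
  Z (p ++ (k *: u + v) :: q) b = k *: Z (p ++ u :: q) b + Z (p ++ v :: q) b.
Proof.
(* [M_deg1] says nothing about an empty second argument; there [zero_extend] is 0 by definition. *)
case: b => [|w b] /=; first by rewrite scaler0 addr0.
have [Ml _ _] := @M_deg1 (size p + size q).+1 (size (w :: b)) isT.
by have [-> //] := Ml (w :: b) erefl.
Qed.

Lemma zero_extend_linr (k : K) u v a p q :
  Z a (p ++ (k *: u + v) :: q) = k *: Z a (p ++ u :: q) + Z a (p ++ v :: q).
Proof.
have ZE w : Z a (p ++ w :: q) = M a (p ++ w :: q) by case: (p).
have [_ Mr _] := @M_deg1 (size a) (size p + size q).+1 isT.
by rewrite !ZE; have [-> //] := Mr a erefl.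
Qed.

Lemma zero_extend0l p q b : Z (p ++ 0 :: q) b = 0.
Proof.
(* Linearity at [-1 *: 0 + 0] writes the value as minus itself plus itself. *)
have := zero_extend_linl (-1) 0 0 p q b.
by rewrite scaler0 addr0 scaleN1r addNr.
Qed.

Lemma zero_extend0r a p q : Z a (p ++ 0 :: q) = 0.
Proof.
have := zero_extend_linr (-1) 0 0 a p q.
by rewrite scaler0 addr0 scaleN1r addNr.
Qed.

Lemma zero_extend_symm_l i j u v p q b : homog i u -> homog j v ->
  Z (p ++ u :: v :: q) b = sgn (i * j) *: Z (p ++ v :: u :: q) b.
Proof.
move=> hu hv; case: b => [|w b] /=; first by rewrite scaler0.
have [Ml _ _] := @M_deg1 (size p + size q).+2 (size (w :: b)) isT.
by have [_ H] := Ml (w :: b) erefl; apply: H.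
Qed.

Lemma zero_extend_symm_r i j u v a p q : homog i u -> homog j v ->
  Z a (p ++ u :: v :: q) = sgn (i * j) *: Z a (p ++ v :: u :: q).
Proof.
move=> hu hv; have ZE w1 w2 : Z a (p ++ w1 :: w2 :: q) = M a (p ++ w1 :: w2 :: q) by case: (p).
have [_ Mr _] := @M_deg1 (size a) (size p + size q).+2 isT.
by rewrite !ZE; have [_ H] := Mr a erefl; apply: H.
Qed.

Local Arguments zero_extend : simpl never.

Definition homogs s := forall t, t \in s -> homog t.1 t.2.

Lemma homogs_cons t s : homogs (t :: s) <-> homog t.1 t.2 /\ homogs s.
Proof.
split=> [h|[ht hs] u]; last by rewrite inE => /orP[/eqP->|/hs].
by split=> [|u us]; apply: h; rewrite inE ?eqxx ?us ?orbT.
Qed.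

Lemma homogs_cat a b : homogs (a ++ b) <-> homogs a /\ homogs b.
Proof.
split=> [h|[ha hb] t]; last by rewrite mem_cat => /orP[/ha|/hb].
by split=> t ti; apply: h; rewrite mem_cat ti ?orbT.
Qed.

Lemma perm_homogs a b s : perm_eq (a ++ b) s -> homogs s -> homogs a /\ homogs b.
Proof.
move=> ab hs; apply/homogs_cat => t; rewrite (perm_mem ab); exact: hs.
Qed.

Lemma codom_nth (B : Type) (x0 : B) (l : seq B) :
  codom (fun k : 'I_(size l) => nth x0 l k) = l.
Proof.
apply: (@eq_from_nth _ x0); rewrite size_codom_ord // => i il.
by rewrite -[i]/(val (Ordinal il)) nth_codom_ord.
Qed.

Lemma sum_deg_nth s : \sum_(k < size s) (nth (0, 0) s k).1 = deg s.
Proof. by rewrite /deg (big_nth (0, 0)) big_mkord. Qed.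

Lemma deg_codom n (f : 'I_n -> T) : deg (codom f) = \sum_i (f i).1.
Proof. by rewrite /deg codomE big_map big_enum. Qed.

Lemma homogs_codom n (d : 'I_n -> int) (x : 'I_n -> V) :
  homog_family d x -> homogs (codom (fun k => (d k, x k))).
Proof. by move=> h t /codomP[k ->]; apply: h. Qed.

Definition mu a b := Z (vals a) (vals b).

Lemma mu_nilr a : mu a [::] = 0. Proof. by []. Qed.

Lemma homog0 i : homog i (0 : V). Proof. exact: linear0. Qed.

Lemma mu_homog a b : homogs a -> homogs b -> homog (deg a + deg b + 1) (mu a b).
Proof.
move=> ha hb; case: b hb => [|t b] hb; first exact: homog0.
have [_ _ H] := @M_deg1 (size a) (size (t :: b)) isT.
rewrite /mu zero_extendE // -!sum_deg_nth.
have E c : vals c = codom (fun k : 'I_(size c) => (nth (0, 0) c k).2).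
  by rewrite (codom_map snd) codom_nth.
by rewrite !E; apply: H => k; [apply: ha | apply: hb]; rewrite mem_nth.
Qed.

(** This is l^C on tagged homogeneous words, by [lC_homogE] and [lC_vals]. *)
Definition ell s := unsh s mu.

Lemma gproj_linear i : linear (gproj V i).
Proof. by move=> k u v; rewrite linearP. Qed.

Lemma ell_homog s : homogs s -> homog (deg s + 1) (ell s).
Proof.
move=> hs; rewrite /homog /ell (linear_unsh _ _ (gproj_linear _)).
apply: eq_unsh => a b ab; have [ha hb] := perm_homogs ab hs.
by rewrite -(perm_deg ab) deg_cat; apply: mu_homog.
Qed.

Lemma ell_lin_slot (k : K) i (u v : V) p q :
  ell (p ++ (i, k *: u + v) :: q) = k *: ell (p ++ (i, u) :: q) + ell (p ++ (i, v) :: q).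
Proof.
apply: unsh_lin_slot => // a b c; rewrite /mu !vals_cat /=.
  exact: zero_extend_linl.
exact: zero_extend_linr.
Qed.

Lemma ell0 i p q : ell (p ++ (i, 0) :: q) = 0.
Proof.
have := ell_lin_slot (-1) i 0 0 p q.
by rewrite scaler0 addr0 scaleN1r addNr.
Qed.

Lemma ell_exchange i j (u v : V) p q : homog i u -> homog j v ->
  ell (p ++ (i, u) :: (j, v) :: q) = sgn (i * j) *: ell (p ++ (j, v) :: (i, u) :: q).
Proof.
move=> hu hv; apply: unsh_exchange => a b c; rewrite /mu !vals_cat /=.
  exact: zero_extend_symm_l.
exact: zero_extend_symm_r.
Qed.

Lemma map_snd_codom n (f : 'I_n -> T) : codom (fun k => (f k).2) = vals (codom f).
Proof. exact: codom_map. Qed.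

Lemma lC_homogE n (d : 'I_n -> int) (x : 'I_n -> V) :
  lC_homog M d x = ell (codom (fun k => (d k, x k))).
Proof.
(* The unshuffle sum also contains the length [j = n]; its second argument is empty, so that term is
   0. *)
rewrite /ell -all_shuffle2_sumE big_nat_recr //= [X in _ + X]big1 ?addr0 => [|s _]; last first.
  by rewrite drop_oversize ?size_codom_ord // mu_nilr scaler0.
rewrite /lC_homog; apply: eq_big_nat => j /andP[_ jn].
apply: eq_bigr => s _; congr (_ *: _).
rewrite (map_snd_codom (fun a => (d (s a), x (s a)))) /mu -vals_take -vals_drop.
rewrite -zero_extendE // -size_eq0 size_drop size_codom_ord; lia.
Qed.

Lemma lC_vals s : homogs s -> lC M (vals s) = ell s.
Proof.
move=> hs; have szs : size (vals s) = size s by rewrite size_map.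
have nthE (k : 'I_(size (vals s))) : (vals s)`_k = (nth (0, 0) s k).2.
  by rewrite (nth_map (0, 0)) // -szs.
rewrite (@lCE _ _ _ _ (fun k => (nth (0, 0) s k).1)) //; last first.
  by move=> k; rewrite nthE; apply: hs; rewrite mem_nth -?szs.
rewrite lC_homogE; congr ell; apply: (@eq_from_nth _ (0, 0)); rewrite size_codom_ord // => i il.
by rewrite -[i]/(val (Ordinal il)) nth_codom_ord nthE; case: (nth _ _ _).
Qed.


(** * The multilinear extension of l^C to arbitrary arguments *)

(* A finite and recursive form of the infinite sum over degrees in [lC], see [lC_hsum]. *)
Fixpoint hsum (S : seq int) (xs : seq V) (F : seq T -> V) : V :=
  if xs is x :: xs' then \sum_(i <- S) hsum S xs' (fun l => F ((i, gproj V i x) :: l))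
  else F [::].

Lemma eq_hsum S xs F G : F =1 G -> hsum S xs F = hsum S xs G.
Proof.
elim: xs F G => [|x xs IH] F G FG /=; first exact: FG.
by apply: eq_bigr => i _; apply: IH => l.
Qed.

Lemma hsum_lin S xs k F G :
  hsum S xs (fun l => k *: F l + G l) = k *: hsum S xs F + hsum S xs G.
Proof.
elim: xs F G => //= x xs IH F G; rewrite scaler_sumr -big_split /=.
by apply: eq_bigr => i _; rewrite IH.
Qed.

Lemma hsum0 S xs : hsum S xs (fun _ => 0) = 0.
Proof. by elim: xs => //= x xs IH; rewrite big1. Qed.

Lemma hsumZ S xs k F : hsum S xs (fun l => k *: F l) = k *: hsum S xs F.
Proof.
by rewrite -[RHS]addr0 -[X in _ + X](hsum0 S xs) -hsum_lin; apply: eq_hsum => l; rewrite addr0.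
Qed.

Lemma hsum_cat S xs ys F :
  hsum S (xs ++ ys) F = hsum S xs (fun l => hsum S ys (fun l' => F (l ++ l'))).
Proof. by elim: xs F => //= x xs IH F; apply: eq_bigr => i _; rewrite IH. Qed.

Fixpoint words (S : seq int) n : seq (seq int) :=
  if n is n'.+1 then [seq i :: w | i <- S, w <- words S n'] else [:: [::]].

Lemma words_uniq S n : uniq S -> uniq (words S n).
Proof. by move=> uS; elim: n => //= n IH; apply: allpairs_uniq => // -[? ?] [? ?] _ _ [-> ->]. Qed.

Lemma mem_words S n w : (w \in words S n) = (size w == n) && all (mem S) w.
Proof.
elim: n w => [|n IH] w /=; first by rewrite inE; case: w.
apply/allpairsP/andP => [[[i v] /= [iS vS ->]]|].
  by move: vS; rewrite IH /= eqSS iS => /andP[-> ->].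
case: w => [[]//|i v [sz /andP[iS vS]]]; exists (i, v); split=> //=.
by rewrite IH (vS : all (mem S) v) andbT -eqSS.
Qed.

Lemma hsum_words S xs F :
  hsum S xs F = \sum_(w <- words S (size xs)) F [seq (p.1, gproj V p.1 p.2) | p <- zip w xs].
Proof.
elim: xs F => [|x xs IH] F /=; first by rewrite big_seq1.
by rewrite big_allpairs_dep; apply: eq_bigr => i _; rewrite IH.
Qed.

Definition supported (S : seq int) (xs : seq V) :=
  forall x i, x \in xs -> i \notin S -> gproj V i x = 0.

(** By orthogonality, a vector has no component outside the finite list given by [gproj_sum]; the
    union of these lists serves all of [xs]. *)
Lemma supportedP (xs : seq V) : exists2 S, uniq S & supported S xs.
Proof.
elim: xs => [|x xs [S _ HS]]; first by exists [::].
have [r _ xE] := gproj_sum x.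
exists (undup (r ++ S)) => [|y i]; first exact: undup_uniq.
rewrite mem_undup mem_cat negb_or inE => /orP[/eqP ->|yxs] /andP[ir iS]; last exact: HS.
rewrite xE linear_sum /= big_seq big1 // => j jr; rewrite gproj_ortho.
by case: eqP ir => // ->; rewrite jr.
Qed.

(** Any finite degree set containing the supports may be used, so [lC] can be compared on several
    lists over one common set. *)
Lemma lC_hsum S xs : uniq S -> supported S xs -> lC M xs = hsum S xs ell.
Proof.
move=> uS HS; rewrite hsum_words /lC.
pose ff (w : seq int) : {ffun 'I_(size xs) -> int} := [ffun a : 'I_(size xs) => w`_a].
pose G (d : {ffun 'I_(size xs) -> int}) := lC_homog M d (fun a => gproj V (d a) xs`_a).
have ff_inj : {in words S (size xs) &, injective ff}.
  move=> v w; rewrite !mem_words => /andP[/eqP sv _] /andP[/eqP sw _] /ffunP vw.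
  apply: (@eq_from_nth _ 0); rewrite sv ?sw // => i il.
  by have := vw (Ordinal il); rewrite !ffunE.
rewrite -[LHS]/(\sum_(d \in [set: {ffun 'I_(size xs) -> int}]%classic) G d).
transitivity (\sum_(d <- [seq ff w | w <- words S (size xs)]) G d).
  rewrite [RHS]fsbig_seq ?map_inj_in_uniq ?words_uniq //.
  (* A degree function not coming from a word in [S] takes a value outside [S]; it projects some
     argument to 0 and contributes nothing. *)
  apply/esym/fsbig_widen => // d [_ /= dr].
  suff [a aS] : exists a, d a \notin S.
    by apply: (@lC_homog0 _ _ _ _ _ _ a) => //; apply: HS => //; rewrite mem_nth.
  apply: contrapT => /forallNP aS; apply: dr; apply/mapP; exists (codom d).
    rewrite mem_words size_codom_ord eqxx; apply/allP => _ /codomP[a ->].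
    by apply/negPn/negP; exact: aS.
  by apply/ffunP => a; rewrite ffunE nth_codom_ord.
rewrite big_map big_seq [RHS]big_seq; apply: eq_bigr => w.
rewrite mem_words => /andP[/eqP sw _]; rewrite /G lC_homogE; congr ell.
apply: (@eq_from_nth _ (0, 0)); rewrite size_codom_ord ?size_map ?size_zip ?sw ?minnn // => i il.
rewrite -[i]/(val (Ordinal il)) nth_codom_ord (nth_map (0, 0)) ?size_zip ?sw ?minnn //.
by rewrite nth_zip //= ffunE.
Qed.

Lemma lC_sym_linear k : sym_linear k (lC M).
Proof.
split=> [p q c x y _|p q i j x y _ hx hy].
  (* One degree set for all the vectors makes the three sums range over the same indices. *)
  have [S uS HS] := supportedP (p ++ q ++ [:: x; y; c *: x + y]).
  rewrite !(lC_hsum uS) => [|z n zpq|z n zpq|z n zpq];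
    try by apply: HS; move: zpq; rewrite !(mem_cat, inE) => /or3P[]->; rewrite ?orbT.
  rewrite !hsum_cat -hsum_lin; apply: eq_hsum => l /=.
  rewrite scaler_sumr -big_split /=; apply: eq_bigr => i _; rewrite -hsum_lin.
  by apply: eq_hsum => l'; rewrite linearP ell_lin_slot.
have [S uS HS] := supportedP (p ++ q ++ [:: x; y]).
rewrite !(lC_hsum uS) => [|z n zpq|z n zpq];
  try by apply: HS; move: zpq; rewrite !(mem_cat, inE) => /or4P[]->; rewrite ?orbT.
rewrite !hsum_cat -hsumZ; apply: eq_hsum => l /=; rewrite exchange_big /= scaler_sumr.
apply: eq_bigr => j' _; rewrite scaler_sumr; apply: eq_bigr => i' _.
rewrite -hsumZ; apply: eq_hsum => l'.
(* By homogeneity, only the components of degrees [i] of [x] and [j] of [y] can be nonzero.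
   [cat_rcons] moves the first of the two letters into the prefix, so that [ell0] also applies to
   the second. *)
have [<-|ii'] := eqVneq i i'; last first.
  by rewrite -hx gproj_ortho eq_sym (negbTE ii') ell0 -cat_rcons ell0 scaler0.
have [<-|jj'] := eqVneq j j'; last first.
  by rewrite -hy gproj_ortho eq_sym (negbTE jj') ell0 -cat_rcons ell0 scaler0.
by rewrite (hx : _ = x) (hy : _ = y); apply: ell_exchange.
Qed.

Lemma lC_sym_map1 k : sym_map1 k (lC M).
Proof.
split=> [|d x hx]; first exact: lC_sym_linear.
rewrite (map_snd_codom (fun a => (d a, x a))) lC_vals; last exact: homogs_codom.
rewrite -(deg_codom (fun a => (d a, x a))).
by apply: ell_homog; apply: homogs_codom.
Qed.

Lemma zero_extend_sym_bimap1 p q : sym_bimap1 p q Z.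
Proof.
split=> [ys _|xs _|d x e y hx hy].
- split=> *; [exact: zero_extend_linl | exact: zero_extend_symm_l].
- split=> *; [exact: zero_extend_linr | exact: zero_extend_symm_r].
have := mu_homog (homogs_codom hx) (homogs_codom hy).
by rewrite !deg_codom /mu -!map_snd_codom.
Qed.


(** * The three families of relations as unshuffle sums *)

(** In the first sum, linearity of the outer operation collects the inner products into [ell]. The
    sign in the second comes from moving the inner operation, of degree 1, past [a]. *)
Definition postLie_rel s (r : seq T) : V :=
  unsh s (fun b a => Z (ell b :: vals a) (vals r)) +
  unsh s (fun a c => unsh r (fun b e => sgn (deg a) *: Z (vals a) (mu c b :: vals e))).

Lemma zero_extend_head_linl a b : linear (fun v => Z (v :: a) b).
Proof. by move=> k u v; apply: (zero_extend_linl _ _ _ [::]). Qed.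

Lemma zero_extend_head_linr a b : linear (fun v => Z a (v :: b)).
Proof. by move=> k u v; apply: (zero_extend_linr _ _ _ _ [::]). Qed.

Lemma zero_extend0_headl a b : Z (0 :: a) b = 0.
Proof. exact: (zero_extend0l [::]). Qed.

Lemma zero_extend0_headr a b : Z a (0 :: b) = 0.
Proof. exact: (zero_extend0r _ [::]). Qed.

Lemma rel_nilr s : postLie_rel s [::] = 0.
Proof.
rewrite /postLie_rel -[RHS](unsh0 V s) -unshD; apply: eq_unsh => a b _.
(* With [r] empty, the outer second argument of the first sum and the inner second argument of the
   second sum are both empty. *)
by rewrite -[LHS]/(0 + sgn (deg a) *: Z (vals a) [:: 0]) zero_extend0_headr scaler0 addr0.
Qed.

(** Up to reindexing, this double sum occurs in both the open-closed and the post-Lie relations, so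
    it is converted once. *)
Lemma nested_term_sumE n m (d : 'I_n -> int) (x : 'I_n -> V) (e : 'I_m -> int) (y : 'I_m -> V) :
  \sum_(0 <= i < n.+1) \sum_(0 <= k < m.+1)
    \sum_(s : 'S_n | shuffle [:: i; n - i]%N s)
    \sum_(t : 'S_m | shuffle [:: k; m - k]%N t)
      (let xs := codom (fun a => x (s a)) in
       let us := codom (fun a => y (t a)) in
       (koszul K d s * koszul K e t
          * (-1) ^ (\sum_(a < n | (a < i)%N) d (s a))) *:
         Z (take i xs) (Z (drop i xs) (take k us) :: drop k us)) =
  unsh (codom (fun k => (d k, x k))) (fun a c =>
    unsh (codom (fun k => (e k, y k))) (fun b e' =>
      sgn (deg a) *: Z (vals a) (mu c b :: vals e'))).
Proof.
rewrite -all_shuffle2_sumE; apply: eq_bigr => i _; rewrite exchange_big /=.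
apply: eq_bigr => s _; rewrite -all_shuffle2_sumE scaler_sumr.
apply: eq_bigr => k _; rewrite scaler_sumr; apply: eq_bigr => t _; lazy zeta.
rewrite !scalerA (map_snd_codom (fun a => (d (s a), x (s a)))).
rewrite (map_snd_codom (fun a => (e (t a), y (t a)))) /mu !vals_take !vals_drop.
by rewrite (deg_take_codom (fun a => (d (s a), x (s a)))).
Qed.

Lemma ell_nil : ell [::] = 0. Proof. by []. Qed.

Lemma homogs_take i s : homogs s -> homogs (take i s).
Proof. by move=> hs t /mem_take; exact: hs. Qed.

Lemma homogs_drop i s : homogs s -> homogs (drop i s).
Proof. by move=> hs t /mem_drop; exact: hs. Qed.

Lemma open_closed_lhsE n m (d : 'I_n -> int) (x : 'I_n -> V) (e : 'I_m -> int) (y : 'I_m -> V) :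
  homog_family d x ->
  \sum_(1 <= i < n.+1) \sum_(s : 'S_n | shuffle [:: i; n - i]%N s)
    (let xs := codom (fun k => x (s k)) in
     koszul K d s *: Z (lC M (take i xs) :: drop i xs) (codom y))
  + \sum_(0 <= i < n.+1) \sum_(0 <= k < m.+1)
    \sum_(s : 'S_n | shuffle [:: i; n - i]%N s)
    \sum_(t : 'S_m | shuffle [:: k; m - k]%N t)
      (let xs := codom (fun a => x (s a)) in
       let us := codom (fun a => y (t a)) in
       (koszul K d s * koszul K e t
          * (-1) ^ (\sum_(a < n | (a < i)%N) d (s a))) *:
         Z (take i xs) (Z (drop i xs) (take k us) :: drop k us)) =
  postLie_rel (codom (fun k => (d k, x k))) (codom (fun k => (e k, y k))).
Proof.
move=> hx; rewrite nested_term_sumE; congr (_ + _).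
(* The splitting with empty first block, absent from the open-closed sum, vanishes because [ell
   [::]] is 0. *)
rewrite -all_shuffle2_sumE [RHS]big_nat_recl // [X in _ = X + _]big1 ?add0r => [|s _]; last first.
  by rewrite /= take0 ell_nil zero_extend0_headl scaler0.
rewrite big_add1 /=; apply: eq_bigr => i _; apply: eq_bigr => s _ /=.
rewrite (map_snd_codom (fun a => (d (s a), x (s a)))) (map_snd_codom (fun a => (e a, y a))).
congr (_ *: _); rewrite -vals_take -vals_drop lC_vals //.
by apply: homogs_take; apply: homogs_codom => k; apply: hx.
Qed.

Lemma postLie_lhsE n m (d : 'I_n -> int) (x : 'I_n -> V) (e : 'I_m -> int) (y : 'I_m -> V) :
  (1 <= m)%N ->
  \sum_(0 <= j < n) \sum_(1 <= i < n.+1 | (i + j <= n)%N)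
    \sum_(s : 'S_n | shuffle [:: j; i; n - j - i]%N s)
      (let xs := codom (fun k => x (s k)) in
       koszul K d s *:
         M (M (take j xs) (take i (drop j xs)) :: drop (j + i) xs) (codom y))
  + \sum_(0 <= j < n.+1) \sum_(s : 'S_n | shuffle [:: n - j; j]%N s)
    \sum_(1 <= i < m.+1) \sum_(t : 'S_m | shuffle [:: i; m - i]%N t)
      (let xs := codom (fun k => x (s k)) in
       let ys := codom (fun k => y (t k)) in
       (koszul K d s * koszul K e t
          * (-1) ^ (\sum_(k < n | (k < n - j)%N) d (s k))) *:
         M (take (n - j) xs)
           (M (drop (n - j) xs) (take i ys) :: drop i ys)) =
  postLie_rel (codom (fun k => (d k, x k))) (codom (fun k => (e k, y k))).
Proof.
move=> m1; have Z_M (a b : seq V) : (0 < size b)%N -> M a b = Z a b by case: b.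
congr (_ + _); last first.
  (* The post-Lie sum is indexed by the number of inner arguments from the first group, the nested
     sum by the number of outer ones; hence the reversal. Terms with empty inner second argument are
     0. *)
  rewrite -nested_term_sumE big_nat_rev /= add0n; apply: eq_big_nat => i /andP[_ ilt].
  rewrite subSS subKn // exchange_big /= [RHS]big_nat_recl // [X in _ = X + _]big1 ?add0r => [|s _]; 
    last first.
    rewrite big1 // => t _; lazy zeta.
    by rewrite take0 zero_extend_nilr zero_extend0_headr scaler0.
  rewrite big_add1; apply: eq_big_nat => k /andP[k1 klt].
  apply: eq_bigr => s _; apply: eq_bigr => t _ /=; rewrite !Z_M //;
    by rewrite size_take_min size_codom_ord; lia.
(* Expanding [ell] in the head slot turns the first sum into a three-block one. *)
transitivity (unsh3 (codom (fun k => (d k, x k))) (fun b c a =>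
    Z (mu b c :: vals a) (codom y))); last first.
  rewrite /unsh3 (map_snd_codom (fun k => (e k, y k))); apply: eq_unsh => b a _.
  by rewrite (linear_unsh _ _ (zero_extend_head_linl _ _)).
(* The extra value [j = n] forces [i = 0], and then the inner second argument is empty; below,
   [i = 0] is discarded for every [j] for the same reason. *)
rewrite -all_shuffle3_sumE big_nat_recr //= [X in _ + X]big1 ?addr0 => [|i ijn]; last first.
  have -> : i = 0%N by lia.
  by rewrite big1 // => s _; rewrite take0 mu_nilr zero_extend0_headl scaler0.
apply: eq_big_nat => j /andP[_ jn].
rewrite [RHS]big_mkcond [RHS]big_nat_recl // [X in _ = X + _](_ : _ = 0) ?add0r; last first.
  case: ifP => // _; rewrite big1 // => s _.
  by rewrite take0 mu_nilr zero_extend0_headl scaler0.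
rewrite [LHS]big_mkcond [LHS]big_add1; apply: eq_big_nat => i /andP[_ ilt].
case: ifP => // ij; apply: eq_bigr => s _; lazy zeta.
rewrite (map_snd_codom (fun a => (d (s a), x (s a)))) /mu !vals_take !vals_drop !Z_M //.
  by rewrite size_take_min size_drop -map_snd_codom size_codom_ord; lia.
by rewrite size_codom_ord.
Qed.


(* Over the four-block unshuffles (A, C, B, E) of s, both sides are the signed sum
   of M(M(C; B) A; E) + M(A; M(C; B) E). *)
Lemma unsh_ell_ell s :
  unsh s (fun b a => ell ((deg b + 1, ell b) :: a)) = unsh s postLie_rel.
Proof.
pose H a b e := sgn (deg a) *: Z (vals a) (ell b :: vals e).
transitivity (unsh s (fun b r => unsh r (fun a e => Z (ell b :: vals a) (vals e))) +
    unsh s (fun b r => unsh r (fun a e => sgn (deg a * deg b) *: H a b e))).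
  rewrite -unshD; apply: eq_unsh => b r _; rewrite -unshD.
  (* The outer [ell] puts its head letter in either group. Crossing [a] costs
     [sgn ((deg b + 1) * deg a)], which splits into the sign in [H] and [sgn (deg a * deg b)]. *)
  rewrite -[LHS]/(unsh ((deg b + 1, ell b) :: r) mu) /=; apply: eq_unsh => a e _.
  rewrite /H scalerA -sgnD; congr (_ + _ *: _); congr (sgn _); rewrite /=; ring.
rewrite /postLie_rel [RHS]unshD; congr (_ + _); first by rewrite -unsh_coassoc.
rewrite -unsh_coassoc.
(* Cocommutativity exchanges [a] and [b], and its sign cancels the remaining
   [sgn (deg a * deg b)]. *)
under eq_unsh => x e _ do rewrite unsh_swap.
transitivity (unsh s (fun x e => unsh x (fun a b => H a b e))).
  apply: eq_unsh => x e _; apply: eq_unsh => a b _.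
  by rewrite scalerA sgn_sqr scale1r.
rewrite unsh_coassoc.
(* Both sides are brought to the right-nested four-block sum with blocks in the order [a], [c], [b],
   [e]. *)
transitivity (unsh s (fun a r => unsh r (fun c y => unsh y (fun b e =>
    sgn (deg a) *: Z (vals a) (mu c b :: vals e))))); last by rewrite -unsh_coassoc.
apply: eq_unsh => a r _; rewrite -unsh_coassoc; apply: eq_unsh => b e _.
by rewrite /H (linear_unsh _ _ (zero_extend_head_linr _ _)) -unshZ.
Qed.

Lemma Linfty_lhsE n (d : 'I_n -> int) (x : 'I_n -> V) : homog_family d x ->
  \sum_(1 <= i < n.+1) \sum_(s : 'S_n | shuffle [:: i; n - i]%N s)
    (let xs := codom (fun k => x (s k)) in
     koszul K d s *: lC M (lC M (take i xs) :: drop i xs)) =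
  unsh (codom (fun k => (d k, x k))) postLie_rel.
Proof.
move=> hx; rewrite -unsh_ell_ell -all_shuffle2_sumE [RHS]big_nat_recl //.
rewrite [X in _ = X + _]big1 ?add0r => [|s _]; last first.
  by rewrite /= take0 ell_nil (ell0 _ [::]) scaler0.
rewrite [LHS]big_add1; apply: eq_bigr => i _; apply: eq_bigr => s _; lazy zeta.
rewrite (map_snd_codom (fun a => (d (s a), x (s a)))); set l := codom _.
have hl : homogs l by apply: homogs_codom => k; apply: hx.
have ht : homogs (take i.+1 l) by apply: homogs_take.
rewrite -vals_take -vals_drop lC_vals //; congr (_ *: _).
(* The inner value is homogeneous of degree one more than its block, so it can be tagged and
   [lC_vals] applies a second time. *)
rewrite -[_ :: _]/(vals ((deg (take i.+1 l) + 1, ell (take i.+1 l)) :: drop i.+1 l)).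
rewrite lC_vals //; apply/homogs_cons; split; first exact: ell_homog.
exact: homogs_drop.
Qed.

(** This passes from families indexed by ordinals to lists, the form in which coproduct blocks
    appear; the case of empty [r] is supplied by [rel_nilr]. *)
Lemma rel_eq0P :
  (forall n m (d : 'I_n -> int) (x : 'I_n -> V) (e : 'I_m -> int) (y : 'I_m -> V),
     (1 <= m)%N -> homog_family d x -> homog_family e y ->
     postLie_rel (codom (fun k => (d k, x k))) (codom (fun k => (e k, y k))) = 0) ->
  forall s r, homogs s -> homogs r -> postLie_rel s r = 0.
Proof.
move=> rel0 s [|t r] hs hr; first exact: rel_nilr.
have codom_pair (l : seq T) :
    codom (fun k : 'I_(size l) => ((nth (0, 0) l k).1, (nth (0, 0) l k).2)) = l.
  by rewrite -[RHS](codom_nth (0, 0)); apply: eq_codom => k; case: nth.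
rewrite -(codom_pair s) -(codom_pair (t :: r)); apply: rel0 => // k.
  by apply: hs; apply: mem_nth.
by apply: hr; apply: mem_nth.
Qed.

Lemma postLie_open_closed :
  postLie_infty M <-> open_closed_homotopy_Lie (lC M) Z.
Proof.
split=> [[_ pL]|[_ _ _ oc]].
  have rel0 : forall s r, homogs s -> homogs r -> postLie_rel s r = 0.
    by apply: rel_eq0P => n m d x e y m1 hx hy; rewrite -postLie_lhsE //; apply: pL.
  split=> // [|p q _|n m d x e y _ hx hy].
  - split=> [k _|n d x _ hx]; first exact: lC_sym_map1.
    (* The relation of l^C is a sum of [postLie_rel] over splittings of the arguments, and every
       summand vanishes, including those with an empty block. *)
    rewrite Linfty_lhsE // -[RHS](unsh0 V (codom (fun k => (d k, x k)))).
    apply: eq_unsh => a b ab; have [ha hb] := perm_homogs ab (homogs_codom hx).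
    exact: rel0.
  - exact: zero_extend_sym_bimap1.
  by rewrite open_closed_lhsE // rel0 //; apply: homogs_codom.
split=> // n m d x e y m1 hx hy; rewrite postLie_lhsE // -open_closed_lhsE //.
by apply: oc => //; rewrite addn_gt0 m1 orbT.
Qed.

End PostLie.

Theorem theorem4p13 (K : fieldType) (charK : [pchar K]%R =i pred0)
    (V : gradedSpace K) (M : seq V -> seq V -> V)
    (M_deg1 : forall p q : nat, 1 <= q -> sym_bimap1 p q M) :
  postLie_infty M <-> open_closed_homotopy_Lie (lC M) (zero_extend M).
Proof. exact: postLie_open_closed. Qed.
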